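(* Let $s(N),t(N)$ be non-decreasing functions. Any $(s(N),t(N))$-implementation of resizable arrays must satisfy $s(N)\,t(N)\ge N$ (for every $N$), and this holds even if only grow and access operations are performed.
   Context: A resizable array stores a sequence $a_0,\dots,a_{N-1}$ ($N$ is its current size) and supports: creating an empty array, returning its length, reading or overwriting the $i$-th item ($0\le i<N$), Grow$(a)$ which appends a new last item $a$, and Shrink() which removes the last item. An implementation keeps its data in dynamically allocated fixed-length contiguous blocks of memory words (blocks may be allocated and deallocated at any time); each item occupies one word and each pointer occupies one word; every block other than a single main index block must be pointed to by a pointer stored in some block (otherwise it would be inaccessible). The space used at any moment is the total length of all currently allocated blocks. For non-decreasing functions $s,t$, an $(s(N),t(N))$-implementation is one that uses at most $N+s(N)$ space to store an array of size $N$, and at most $N+t(N)$ space at any moment during a grow or shrink operation on an array of size $N$.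
   Formalization: The main index block is additionally required to hold no items between operations; otherwise an array kept entirely in that one unpointed block, reallocated at each grow, has s(N)=0 and t(N)=N+1, so s(N)t(N)<N. *)

(* Defs.v *)
From HB Require Import structures.
From mathcomp Require Import all_boot all_order all_algebra.
From mathcomp Require Import finmap.

Set Implicit Arguments.
Unset Strict Implicit.
Unset Printing Implicit Defensive.

Import Order.TTheory GRing.Theory Num.Theory.
Local Open Scope fset_scope.
Local Open Scope fmap_scope.

Section Memory.
Variable T : Type. (* the items *)

Inductive word :=
| Item of T
| Ptr of nat (* pointer to the block with this name *)
| Aux of nat. (* anything else: counters, sizes, blank words *)

Definition heap := {fmap nat -> seq word}.

(* [index m] names the main index block. It is known without being stored in
   a word; it need not be allocated (e.g. for an empty heap). *)
Record memory := Memory { blocks : heap; index : nat }.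

Definition empty_memory : memory := Memory [fmap] 0.

Definition space (m : memory) : nat :=
  \sum_(b : domf (blocks m)) size (blocks m b).

(* An address is a block name and an offset. *)
Definition read (h : heap) (d : nat * nat) : option word :=
  if h.[? d.1] is Some ws then onth ws d.2 else None.

Definition put (h : heap) (d : nat * nat) (w : word) : heap :=
  if h.[? d.1] is Some ws then h.[d.1 <- set_nth w ws d.2 w] else h.

(* Items are opaque: an item can be written only if it is the operand [x] of
   the operation in progress or a copy of an item found in memory. Pointers
   and auxiliary words can be written freely. Consequently pairwise distinct
   items that can still be read later are held, each in a word of its own, at
   every moment. This is not assumed separately. *)
Definition writable (x : option T) (m : memory) (w : word) : Prop :=
  if w is Item y then
    x = Some y \/ exists d, read (blocks m) d = Some (Item y)
  else True.

Inductive step (x : option T) (m : memory) : memory -> Prop :=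
| step_alloc b n of b \notin domf (blocks m) :
    step x m (Memory (blocks m).[b <- nseq n (Aux 0)] (index m))
| step_free b of b \in domf (blocks m) :
    step x m (Memory (blocks m).[~ b] (index m))
| step_write d w of read (blocks m) d <> None & writable x m w :
    step x m (Memory (put (blocks m) d w) (index m))
| step_index b : step x m (Memory (blocks m) b).

(* [trace] lists the memories following [m], one primitive step at a time. *)
Fixpoint execution (x : option T) (m : memory) (trace : seq memory) : Prop :=
  if trace is m' :: trace' then step x m m' /\ execution x m' trace' else True.

Definition pointed (m : memory) (b : nat) : Prop :=
  exists d, read (blocks m) d = Some (Ptr b).

Definition blocks_pointed (m : memory) : Prop :=
  forall b, b \in domf (blocks m) -> b <> index m -> pointed m b.

(* The main index block, being exempt from the need of a stored pointer, is
   purely an index: otherwise an array kept in that block alone, with no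
   pointer at all, would have s(N) = 0. *)
Definition index_without_items (m : memory) : Prop :=
  forall i x, read (blocks m) (index m, i) <> Some (Item x).

End Memory.

Arguments Ptr {T} _.
Arguments Aux {T} _.

Section Arrays.
Variable T : Type.

Inductive op :=
| Length
| Get of nat
| Set_ of nat & T
| Grow of T
| Shrink.

Definition legal (o : op) (a : seq T) : bool :=
  match o with
  | Get i | Set_ i _ => i < size a
  | Shrink => 0 < size a
  | Length | Grow _ => true
  end.

Definition effect (o : op) (a : seq T) : seq T :=
  match o with
  | Length | Get _ => a
  | Set_ i x => set_nth x a i x
  | Grow x => rcons a x
  | Shrink => take (size a).-1 a
  end.

Definition operand (o : op) : option T :=
  match o with Set_ _ x | Grow x => Some x | _ => None end.

Definition resizing (o : op) : bool :=
  match o with Grow _ | Shrink => true | _ => false end.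

Definition all_ops (o : op) : bool := true.

Definition grow_access_ops (o : op) : bool :=
  if o is Shrink then false else true.

(* The behaviour of an implementation is a function of the memory. [create]
   and [perform] give the memories passed through, excluding the starting one;
   the replies are made in the memory reached at the end of the operation.
   [Get] replies with the address of a word, as items are opaque. *)
Record implementation := Implementation {
  create : seq (memory T);
  perform : memory T -> op -> seq (memory T);
  length_reply : memory T -> nat;
  get_reply : memory T -> nat -> nat * nat
}.

Definition after (I : implementation) (m : memory T) (o : op) : memory T :=
  last m (perform I m o).

(* [reachable ops I m a]: some sequence of operations from [ops] performed on
   a newly created array leads to the array [a], held in memory [m]. *)
Inductive reachable (ops : op -> bool) (I : implementation) :
    memory T -> seq T -> Prop :=
| reachable_create :
    reachable ops I (last (empty_memory T) (create I)) [::]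
| reachable_perform m a o of reachable ops I m a & ops o & legal o a :
    reachable ops I (after I m o) (effect o a).

Local Open Scope ring_scope.

(* The conditions on pointers and on the index block are imposed only between
   operations: while an operation runs, a pointer may still be in a register. *)
Record st_implementation (R : realFieldType) (ops : op -> bool)
    (s t : nat -> R) (I : implementation) : Prop := {
  create_execution : execution None (empty_memory T) (create I);
  perform_execution : forall m a o, reachable ops I m a -> ops o ->
    legal o a -> execution (operand o) m (perform I m o);
  length_correct : forall m a, reachable ops I m a -> ops Length ->
    length_reply I (after I m Length) = size a;
  get_correct : forall m a i, reachable ops I m a -> ops (Get i) ->
    (i < size a)%N ->
    read (blocks (after I m (Get i))) (get_reply I (after I m (Get i)) i)
    = omap (@Item T) (onth a i);
  rest_pointed : forall m a, reachable ops I m a -> blocks_pointed m;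
  rest_index : forall m a, reachable ops I m a -> index_without_items m;
  rest_space : forall m a, reachable ops I m a ->
    (space m)%:R <= (size a)%:R + s (size a);
  moment_space : forall m a o, reachable ops I m a -> ops o -> legal o a ->
    all (fun m' => (space m')%:R <=
           (size a)%:R + (if resizing o then t else s) (size a))
        (m :: perform I m o)
}.

End Arrays.

Arguments all_ops {T} _.
Arguments grow_access_ops {T} _.

(* Main.v *)
(* Grow an array of N pairwise distinct items. As items are opaque, each of the
   first n of them occupies a word of its own at every moment of the grow
   operation that starts from size n, so a block of length L allocated during
   that operation needs n + L <= n + t(n) words. Blocks allocated at creation
   are still there when the first grow starts, unless freed, so L <= t(0) for
   them. Hence L <= t(N) for every block. In the final memory the items lie in
   k non-index blocks, so N <= k t(N); the k pointers to these blocks are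
   further words, so N + k <= N + s(N). *)
Require Import Defs.
From HB Require Import structures.
From mathcomp Require Import all_boot all_order all_algebra.
From mathcomp Require Import finmap.
Import Defs. (* [space] is also a name of MathComp's [vector] *)

Set Implicit Arguments.
Unset Strict Implicit.
Unset Printing Implicit Defensive.

Import Order.TTheory GRing.Theory Num.Theory.
Local Open Scope fset_scope.
Local Open Scope fmap_scope.
Local Open Scope ring_scope.

Section Heaps.
Variable T : Type.
Implicit Types (m : memory T) (w : word T) (y : T).

Definition held m w : Prop := exists d, read (blocks m) d = Some w.

Definition block_lengths_le (R : realFieldType) (B : R) m : Prop :=
  forall b ws, (blocks m).[? b] = Some ws -> (size ws)%:R <= B.

(** Choosing an address for each word is injective, since one address reads as only one word, and
    the space counts all addresses. *)
Lemma card_le_space (J : finType) (F : J -> word T) m :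
  injective F -> (forall j, held m (F j)) -> (#|J| <= space m)%N.
Proof.
move=> F_inj /fin_all_exists[d dP].
have d_inj : injective d.
  by move=> i j eq_d; apply: F_inj; apply: Some_inj; rewrite -!dP eq_d.
pose addresses := [seq (val b, i) | b <- enum {: domf (blocks m)},
                                    i <- iota 0 (size (blocks m b))].
have -> : space m = size addresses.
  rewrite size_allpairs_dep sumnE big_map big_enum /=.
  by apply: eq_bigr => b _; rewrite size_iota.
rewrite cardE -(size_map d); apply: uniq_leq_size.
  by rewrite map_inj_uniq ?enum_uniq.
move=> _ /mapP[j _ ->]; move: (dP j); rewrite /read.
case: fndP => // b_dom; case: (d j) b_dom => b i /= b_dom read_i.
apply/allpairsPdep; exists [` b_dom], i; split; rewrite ?mem_enum //.
by rewrite mem_iota /= add0n -onthTE read_i.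
Qed.

Lemma onth_set_nth (A : Type) (a x : A) (v : seq A) i j : (i < size v)%N ->
  onth (set_nth a v i x) j = if j == i then Some x else onth v j.
Proof. by elim: v i j => [|y v IH] [|i] [|j] //=; apply: IH. Qed.

Lemma onth_mkseq (A : Type) (f : nat -> A) n i :
  (i < n)%N -> onth (mkseq f n) i = Some (f i).
Proof.
move=> lt_in; have := onthTE (mkseq f n) i; rewrite size_mkseq lt_in.
by case def_x: onth => [x|] // _; rewrite -(onth_nth x _ _ _ def_x) nth_mkseq.
Qed.

Lemma space_alloc m b n k : b \notin domf (blocks m) ->
  space (Memory (blocks m).[b <- nseq n (Aux 0)] k) = (space m + n)%N.
Proof.
move=> b_new.
(* The index type of the sum in [space] depends on the domain; sums over sets of block names can be
   compared across heaps. *)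
have sumE (m' : memory T) (X : {fset nat}) : domf (blocks m') = X ->
    space m' = (\sum_(c <- X) size (odflt [::] (blocks m').[? c]))%N.
  move=> <-; rewrite /space big_seq_fsetE; apply: eq_bigr => c _.
  by rewrite -Some_fnd.
rewrite (sumE _ (b |` domf (blocks m))) ?dom_setf // (sumE m _ erefl).
rewrite big_fsetU1 //= fnd_set eqxx /= size_nseq addnC.
congr (_ + _)%N; apply: eq_big_seq => c c_in; rewrite fnd_set.
by case: eqP c_in b_new => // -> ->.
Qed.

Lemma size_block_le_space m b ws :
  (blocks m).[? b] = Some ws -> (size ws <= space m)%N.
Proof.
case: fndP => // b_dom [<-]; rewrite /space (bigD1 [` b_dom]) //=.
exact: leq_addr.
Qed.

Lemma space_le (R : realFieldType) (B : R) m :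
  block_lengths_le B m -> (space m)%:R <= #|{: domf (blocks m)}|%:R * B.
Proof.
move=> leB; rewrite natr_sum mulr_natl -sumr_const.
by apply: ler_sum => b _; apply: (leB (val b)); rewrite Some_fnd.
Qed.

(** Allocation yields only blank words, and [writable] lets a write produce only the operand or an
    item already in memory. *)
Lemma step_held x m m' y :
  step x m m' -> x <> Some y -> held m' (Item y) -> held m (Item y).
Proof.
move=> st neq_xy.
case: st => [b n _|b _|d w d_ok w_ok|b] [[c i]] //=; rewrite /read /=.
- rewrite fnd_set; case: eqP => _; last by move=> ?; exists (c, i).
  by rewrite onth_nseq; case: ifP.
- by rewrite fnd_rem1; case: eqP => // _ ?; exists (c, i).
- move: d_ok; rewrite /put /read.
  case def_ws: (blocks m).[? d.1] => [ws|] // d_ok.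
  rewrite fnd_set; case: eqP => [_|_]; last by move=> ?; exists (c, i).
  rewrite onth_set_nth; last by rewrite -onthTE; case: onth d_ok.
  case: eqP => _; last by move=> ?; exists (d.1, i); rewrite /read /= def_ws.
  by case=> def_w; move: w_ok; rewrite def_w => -[].
- by move=> ?; exists (c, i).
Qed.

Lemma execution_held x m tr y : execution x m tr -> x <> Some y ->
  held (last m tr) (Item y) -> held m (Item y).
Proof.
elim: tr m => //= m' tr IH m [st ex] neq_xy /(IH _ ex neq_xy).
exact: step_held st neq_xy.
Qed.

(** Only allocation matters: [n] words are already in use, so a new block of length [k] gives
    [n + k <= n + B]. *)
Lemma step_block_lengths_le (R : realFieldType) (B : R) n x m m' :
  step x m m' -> (n <= space m)%N -> (space m')%:R <= n%:R + B ->
  block_lengths_le B m -> block_lengths_le B m'.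
Proof.
case=> [b k b_new|b _|d w d_ok _|b] // le_n_m le_m' leB c ws /=.
- rewrite fnd_set; case: eqP => _; last exact: leB.
  case=> <-; rewrite size_nseq -(lerD2l n%:R) -natrD.
  apply: le_trans le_m'; rewrite ler_nat space_alloc //.
  by rewrite leq_add2r.
- by rewrite fnd_rem1; case: eqP => // _; apply: leB.
- move: d_ok; rewrite /put /read.
  case def_vs: (blocks m).[? d.1] => [vs|] // d_ok.
  rewrite fnd_set; case: eqP => [_ [<-]|_]; last exact: leB.
  (* The offset is valid, so [set_nth] does not lengthen the block. *)
  rewrite size_set_nth (maxn_idPr _); first exact: leB def_vs.
  by rewrite -onthTE; case: onth d_ok.
Qed.

(** Items held at the end and different from the operand are traced back to every earlier memory, so
    at least [n] words are in use before each step. *)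
Lemma execution_block_lengths_le (R : realFieldType) (B : R) n (g : 'I_n -> T)
    x m tr :
  injective g -> (forall i, x <> Some (g i)) -> execution x m tr ->
  (forall i, held (last m tr) (Item (g i))) ->
  all (fun m' => (space m')%:R <= n%:R + B) tr ->
  block_lengths_le B m -> block_lengths_le B (last m tr).
Proof.
move=> g_inj neq_xg; elim: tr m => //= m' tr IH m [st ex] held_g.
case/andP=> le_m' le_tr leB; apply: (IH m') => //.
apply: step_block_lengths_le (st) _ le_m' leB.
rewrite -[n]card_ord; apply: (@card_le_space _ (fun i => Item (g i))).
  by move=> i j [] /g_inj.
move=> i; apply: (step_held st (neq_xg i)).
exact: execution_held ex (neq_xg i) (held_g i).
Qed.

End Heaps.

Section Implementations.
Variables (R : realFieldType) (T : Type) (ops : op T -> bool) (s t : nat -> R).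
Variable I : implementation T.
Hypothesis ops_grow : forall x, ops (Grow x).
Hypothesis ops_get : forall i, ops (Get _ i).
Hypothesis t_mono : forall m n : nat, (m <= n)%N -> t m <= t n.
Hypothesis I_st : st_implementation ops s t I.

(** A [Get] performed next would have to find the item; having no operand, it cannot introduce
    it. *)
Lemma reachable_held m a i y :
  reachable ops I m a -> onth a i = Some y -> held m (Item y).
Proof.
move=> ma a_i; have lt_i : (i < size a)%N by rewrite -onthTE a_i.
apply: (execution_held (perform_execution I_st ma (ops_get i) lt_i)) => //.
exists (get_reply I (after I m (Get _ i)) i).
by rewrite (get_correct I_st ma) // a_i.
Qed.

Lemma t_ge0 (x : T) n : 0 <= t n.
Proof.
apply: le_trans (t_mono (leq0n n)); rewrite -[t 0]add0r.
have /andP[le_t _] := moment_space I_st (reachable_create _ _) (ops_grow x) isT.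
exact: le_trans (ler0n _ _) le_t.
Qed.

Lemma reachable_mkseq (f : nat -> T) n : injective f ->
  exists2 m, reachable ops I m (mkseq f n) & block_lengths_le (t n) m.
Proof.
move=> f_inj; elim: n => [|n [m ma leB]].
  exists (last (empty_memory T) (create I)); first exact: reachable_create.
  move=> b ws /size_block_le_space le_ws.
  have /andP[] := moment_space I_st (reachable_create _ _) (ops_grow (f 0)) isT.
  by rewrite add0r => le_t _; apply: le_trans le_t; rewrite ler_nat.
have m'a := reachable_perform ma (ops_grow (f n)) isT.
exists (after I m (Grow (f n))); first by rewrite mkseqS.
(* The grow starts from size [n], so it is bounded by [t n]; monotonicity passes to [t n.+1]. *)
move=> b ws def_ws; apply: le_trans (t_mono (leqnSn n)).
move: b ws def_ws.
apply: (@execution_block_lengths_le _ _ _ n (fun i => f i) (Some (f n))) leB.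
- by move=> i j /f_inj/val_inj.
- by move=> i [] /f_inj eq_ni; have := ltn_ord i; rewrite -eq_ni ltnn.
- exact: (perform_execution I_st ma (ops_grow (f n))).
- move=> i; apply: (reachable_held (i := i) m'a).
  by rewrite -[effect _ _]mkseqS onth_mkseq // leqW.
- have /andP[_] := moment_space I_st ma (ops_grow (f n)) isT.
  by rewrite size_mkseq.
Qed.

Lemma st_lower_bound (f : nat -> T) N : injective f -> N%:R <= s N * t N.
Proof.
move=> f_inj; have [m ma leB] := reachable_mkseq N f_inj.
have held_f (i : 'I_N) : held m (Item (f i)).
  apply: (reachable_held (i := i) ma).
  exact: onth_mkseq.
(* The index block is dropped: it holds no item, and nothing need point to it. *)
pose m' := Memory (blocks m).[~ index m] (index m).
have le_k_s : #|{: domf (blocks m')}|%:R <= s N.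
  rewrite -(lerD2l N%:R) -natrD.
  have := rest_space I_st ma; rewrite size_mkseq; apply: le_trans.
  rewrite ler_nat -{1}[N]card_ord -card_sum.
  (* The [N] items and one pointer per non-index block are distinct words, all held in [m]. *)
  pose F (j : 'I_N + domf (blocks m')) : word T :=
    match j with inl i => Item (f i) | inr b => Ptr (val b) end.
  apply: (@card_le_space _ _ F).
    by case=> [i|b] [j|c] //= []; [move/f_inj/val_inj-> | move/val_inj->].
  case=> [|b]; first exact: held_f.
  have := valP b; rewrite /= mem_remf1 => /andP[/eqP b_neq b_dom].
  exact: (rest_pointed I_st ma b_dom b_neq).
have le_N : (N <= space m')%N.
  rewrite -[N in (N <= _)%N]card_ord.
  apply: (@card_le_space _ _ (fun i : 'I_N => Item (f i))).
    by move=> i j [] /f_inj/val_inj.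
  move=> i; have [[b k] read_d] := held_f i; exists (b, k).
  move: read_d; rewrite /read /= fnd_rem1; case: eqP => // -> read_d.
  by case: (rest_index I_st ma read_d).
have leB' : block_lengths_le (t N) m'.
  by move=> b ws /=; rewrite fnd_rem1; case: eqP => // _; apply: leB.
(* With [k] blocks in [m'], this is [N <= space m' <= k * t N <= s N * t N]; the last inequality
   needs [0 <= t N]. *)
apply: le_trans (ler_wpM2r (t_ge0 (f 0) N) le_k_s).
by apply: le_trans (space_le leB'); rewrite ler_nat.
Qed.

End Implementations.

Theorem theorem4p2 (R : realFieldType) (T : Type)
    (T_infinite : exists f : nat -> T, injective f)
    (s t : nat -> R)
    (s_mono : forall m n : nat, (m <= n)%N -> s m <= s n)
    (t_mono : forall m n : nat, (m <= n)%N -> t m <= t n)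
    (I : implementation T) :
  (st_implementation all_ops s t I -> forall N : nat, s N * t N >= N%:R) /\
  (st_implementation grow_access_ops s t I ->
     forall N : nat, s N * t N >= N%:R).
Proof.
have [f f_inj] := T_infinite.
by split=> I_st N; apply: st_lower_bound I_st _ _ f_inj.
Qed.
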